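(* Consider the SAMBA algorithm with step size $\alpha\in(0,1)$ satisfying $\alpha<\frac{\Delta}{r^*-\Delta}$, run on a $K$-armed Bernoulli bandit instance with a unique optimal arm against an adaptive adversary with corruption budget $C\ge 0$ (setting described in the context). Then there exist constants $c_1,c_2>0$ depending only on $K$, $\boldsymbol r$ and $\alpha$ (and not on $T$, $C$, or the adversary's strategy) such that for every horizon $T\ge 2$, $$Rg(T)\le c_1\,\frac{K}{\Delta}\log T+c_2\,\frac{C}{\Delta},$$ i.e. $Rg(T)=O\!\left(\frac{K}{\Delta}\log T+\frac{C}{\Delta}\right)$.
   Context: Setting. There are $K$ arms $\mathcal A=\{1,\dots,K\}$ with expected rewards $\boldsymbol r=(r_1,\dots,r_K)\in[0,1]^K$. There is a unique optimal arm $a^*=\arg\max_a r_a$; write $r^*=r_{a^*}$, $\Delta_a=r^*-r_a>0$ for $a\ne a^*$, and $\Delta=\min_{a\ne a^*}\Delta_a$. Rounds are indexed $t=0,1,2,\dots$. Adversary. In each round $t$, knowing the past history $H(t-1)$ of pulled arms and observed rewards and the algorithm's current distribution $p(t)$ (but not the arm $a(t)$ that will be drawn), the adversary chooses corrupted means $\boldsymbol r'(t)\in[0,1]^K$ at cost $c(t)=\max_{a}|r_a-r'_a(t)|$, subject to $\sum_t c(t)\le C$. If arm $a(t)$ is pulled, the observed reward $R(t)\in\{0,1\}$ is drawn from a Bernoulli distribution with mean $r'_{a(t)}(t)$, independently given the past. SAMBA. The algorithm maintains a probability vector $p(t)=(p_1(t),\dots,p_K(t))$ with $p_a(0)=1/K$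 for all $a$. In round $t$: let the leading arm be $a_l=a_l(t)\in\arg\max_a p_a(t)$ (ties broken arbitrarily); draw $a(t)\sim p(t)$ and observe $R(t)$; for every $a\ne a_l$ set $$p_a(t+1)=p_a(t)+\alpha\,p_a(t)^2\left(\frac{R(t)\mathbb 1[a(t)=a]}{p_a(t)}-\frac{R(t)\mathbb 1[a(t)=a_l]}{p_{a_l}(t)}\right),$$ and set $p_{a_l}(t+1)=1-\sum_{a\ne a_l}p_a(t+1)$. Regret: $Rg(T)=\sum_{a\ne a^*}\Delta_a\,\mathbb E\left[\sum_{t=0}^{T-1}p_a(t)\right]$ (true, uncorrupted means are used). *)

(* Defs.v *)
From mathcomp Require Import all_boot all_order all_algebra.
From mathcomp Require Import reals exp.
Set Implicit Arguments. Unset Strict Implicit. Unset Printing Implicit Defensive.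
Import Order.TTheory GRing.Theory Num.Theory.
Local Open Scope ring_scope.

(* Arms are 'I_K; one round's observation is (pulled arm, Bernoulli reward).
   A history is a [seq ('I_K * bool)] stored MOST RECENT FIRST:
   the history before round t (i.e. H(t-1)) has length t. *)
Definition hist (K : nat) := seq ('I_K * bool).

Section Samba.
Variables (R : realType) (K : nat).

Definition samba_update (alpha : R) (l : 'I_K) (p : 'I_K -> R)
    (a : 'I_K) (rw : bool) : 'I_K -> R :=
  let Rt : R := (rw : nat)%:R in
  let q (b : 'I_K) : R :=
    p b + alpha * (p b) ^+ 2 *
      (Rt * ((a == b) : nat)%:R / p b - Rt * ((a == l) : nat)%:R / p l) in
  fun b => if b == l then 1 - \sum_(c | c != l) q c else q b.

(* [lead h p] : the leading arm used in a round with history h and current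
   distribution p (tie-breaking rule, possibly history dependent). *)
Variable lead : hist K -> ('I_K -> R) -> 'I_K.
Variable alpha : R.

Fixpoint samba_p (h : hist K) : 'I_K -> R :=
  match h with
  | [::] => fun _ => 1 / K%:R
  | x :: h' => let p := samba_p h' in
               samba_update alpha (lead h' p) p x.1 x.2
  end.

(* adversary: corrupted means r'(t) as a function of H(t-1)
   (p(t) is itself a deterministic function of H(t-1)). *)
Variable adv : hist K -> 'I_K -> R.

Fixpoint hist_prob (h : hist K) : R :=
  match h with
  | [::] => 1
  | x :: h' => hist_prob h' * samba_p h' x.1 *
               (if x.2 then adv h' x.1 else 1 - adv h' x.1)
  end.

Definition corr_cost (r : 'I_K -> R) (h : hist K) : R :=
  \big[Num.max/0]_(a : 'I_K) `|r a - adv h a|.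

Definition total_cost (r : 'I_K -> R) (h : hist K) : R :=
  \sum_(t < size h) corr_cost r (drop (size h - t) h).

Definition regret (r : 'I_K -> R) (astar : 'I_K) (T : nat) : R :=
  \sum_(a | a != astar) (r astar - r a) *
    \sum_(w : T.-tuple ('I_K * bool))
       hist_prob (val w) * \sum_(t < T) samba_p (drop (T - t) (val w)) a.

End Samba.

(* Main.v *)
Require Import Defs.
From mathcomp Require Import all_boot all_order all_algebra.
From mathcomp Require Import reals exp.
From mathcomp Require Import ring lra.
Import Order.TTheory GRing.Theory Num.Theory.
Local Open Scope ring_scope.

(** Write [x] for the probability of the optimal arm and [q = 1 - x].  The
    Lyapunov function is [V = ln q + M (1/x - B x)], for large [B] and [M].
    Without corruption [x] never decreases in mean: when the leader [l] is
    suboptimal the mean increment of [x] is [alpha x^2 (r* - r_l)], and when the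
    optimal arm leads it is at least [alpha Delta S], with [S] the sum of the
    squared probabilities of the other arms.  As [ln] is concave, [ln q] then
    drifts by at most [- alpha Delta S / q <= - (alpha Delta / K) q] in the second
    case and does not increase in mean in the first one, where the drift of [1/x] is
    [alpha (r_l / (1 - alpha x / p_l) - r* / (1 + alpha))].  This is negative for
    small [x], because the step size condition says [r* / (1 + alpha) > r* - Delta],
    and the term [- B x] compensates it elsewhere; it also absorbs the [O(S)] drift
    of [1/x] when the optimal arm leads.  A corruption [c] changes the drift by
    [O(c)], so [V] drifts by at most [- kappa q + b c] in every state.  Since
    [1 / p_a] grows by at most a constant per round, [V >= - ln T - O(1)] holds
    surely, and summing the drifts bounds the expected sum of the [q]'s. *)

Set Implicit Arguments. Unset Strict Implicit. Unset Printing Implicit Defensive.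

(** * One SAMBA update *)

Section SambaUpdate.
Variables (R : realType) (K : nat) (alpha : R) (l : 'I_K) (p : 'I_K -> R).
Hypothesis alpha01 : 0 < alpha < 1.
Hypothesis p_gt0 : forall a, 0 < p a.
Hypothesis sum_p : \sum_a p a = 1.
Hypothesis lead_p : forall a, p a <= p l.

Lemma sum_samba_update a rw : \sum_b samba_update alpha l p a rw b = 1.
Proof.
rewrite (bigD1 l) //= {1}/samba_update eqxx.
rewrite [X in _ + X](eq_bigr (fun b => p b + alpha * (p b) ^+ 2 *
  ((rw : nat)%:R * ((a == b) : nat)%:R / p b
   - (rw : nat)%:R * ((a == l) : nat)%:R / p l))) ?subrK//.
by move=> b /negPf bl; rewrite /samba_update bl.
Qed.

Lemma samba_update_noreward a b : samba_update alpha l p a false b = p b.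
Proof.
rewrite /samba_update; case: eqP => [->|_]; last by rewrite !mul0r subrr mulr0 addr0.
under eq_bigr do rewrite !mul0r subrr mulr0 addr0.
by rewrite -sum_p (bigD1 l) //= addrK.
Qed.

Lemma samba_update_other a b : b != l ->
  samba_update alpha l p a true b =
  if a == b then (1 + alpha) * p b
  else if a == l then p b * (1 - alpha * (p b / p l)) else p b.
Proof.
move=> bl; rewrite /samba_update (negPf bl); have pb := lt0r_neq0 (p_gt0 b).
have pl := lt0r_neq0 (p_gt0 l).
case: (eqVneq a b) => [->|ab]; first by rewrite (negPf bl) /=; field; rewrite pb pl.
by case: eqP => _ /=; field; rewrite ?pb ?pl ?andbT.
Qed.

(** Mass is conserved, so the leader moves by the opposite of what the other arms move. A rewarded
    pull of [a != l] changes only [a] among the non-leaders, while a rewarded pull of [l] shrinks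
    all of them. *)
Lemma samba_update_lead a :
  samba_update alpha l p a true l =
  if a == l then p l + alpha * (\sum_(c | c != l) p c ^+ 2) / p l
  else p l - alpha * p a.
Proof.
rewrite [LHS](_ : _ = 1 - \sum_(c | c != l) samba_update alpha l p a true c); last first.
  rewrite {1}/samba_update eqxx; congr (1 - _); apply: eq_bigr => c /negPf cl.
  by rewrite /samba_update cl.
have pl := lt0r_neq0 (p_gt0 l).
have sp : 1 = p l + \sum_(c | c != l) p c by rewrite -sum_p (bigD1 l).
case: (eqVneq a l) => [->|al].
  rewrite (eq_bigr (fun c => p c - alpha / p l * p c ^+ 2)); last first.
    move=> c cl; rewrite samba_update_other // eq_sym (negPf cl) eqxx.
    by field.
  rewrite sumrB -mulr_sumr sp; by field.
rewrite sp (bigD1 a al) /= [X in _ - X](bigD1 a al) /= samba_update_other // eqxx.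
rewrite [X in _ - (_ + X)](eq_bigr p); first by ring.
move=> c /andP[cl ca]; rewrite samba_update_other // eq_sym (negPf ca).
by rewrite (negPf al).
Qed.

Lemma lead_ratio b : 0 < p b / p l <= 1.
Proof. by rewrite divr_gt0 // ler_pdivrMr // mul1r lead_p. Qed.

Lemma samba_update_lead_ge a rw : (1 - alpha) * p l <= samba_update alpha l p a rw l.
Proof.
case/andP: alpha01 => a0 a1; have pl := p_gt0 l; have := lead_p a.
case: rw; last by rewrite samba_update_noreward; nra.
rewrite samba_update_lead; case: eqP => _ pa; last by nra.
rewrite (@le_trans _ _ (p l)) //; first by nra.
by rewrite lerDl divr_ge0 ?mulr_ge0 ?sumr_ge0 ?(ltW a0) ?(ltW pl) // => c _; rewrite sqr_ge0.
Qed.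

Lemma samba_update_other_ge a b rw : b != l ->
  p b * (1 - alpha * (p b / p l)) <= samba_update alpha l p a rw b.
Proof.
case/andP: alpha01 => a0 a1 bl; have pb := p_gt0 b; case/andP: (lead_ratio b) => x0 _.
have dec : p b * (1 - alpha * (p b / p l)) <= p b.
  by rewrite ger_pMr // gerBl mulr_ge0 // ltW.
case: rw; last by rewrite samba_update_noreward.
rewrite samba_update_other //; case: eqP => _; last by case: eqP.
by apply: le_trans dec _; nra.
Qed.

Lemma samba_update_gt0 a b rw : 0 < samba_update alpha l p a rw b.
Proof.
case/andP: alpha01 => a0 a1; case: (eqVneq b l) => [->|bl].
  by apply: lt_le_trans (samba_update_lead_ge a rw); rewrite mulr_gt0 // subr_gt0.
apply: lt_le_trans (samba_update_other_ge a rw bl); rewrite mulr_gt0 //.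
by case/andP: (lead_ratio b); nra.
Qed.

Lemma lead_ge_invK : 1 <= K%:R * p l.
Proof.
rewrite -[leLHS]sum_p (le_trans (ler_sum _ (fun a _ => lead_p a))) //.
by rewrite sumr_const card_ord mulr_natl.
Qed.

(** This is the statement that [1 / p b] grows at most linearly in time. A leader has mass at least
    [1 / K] and loses at most a factor [1 - alpha], which the constant [K / (1 - alpha)] absorbs.
    For another arm, with [x = p b / p l], the worst factor is [1 - alpha * x]; the loss [alpha * x]
    is paid for by passing from [n] to [n + 1], because [p b = x * p l] and [K * p l >= 1]. *)
Lemma samba_update_decay a b rw (n : R) : 1 <= n ->
  1 <= K%:R / (1 - alpha) * n * p b ->
  1 <= K%:R / (1 - alpha) * (n + 1) * samba_update alpha l p a rw b.
Proof.
case/andP: alpha01 => a0 a1 n1 H; have a1' : 0 < 1 - alpha by lra.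
have K1 := lead_ge_invK; have pl := p_gt0 l; have pb := p_gt0 b.
have K0 : 0 <= K%:R :> R by [].
set L := K%:R / (1 - alpha) in H *.
have LK : L * (1 - alpha) = K%:R by rewrite /L; field; lra.
have L0 : 0 <= L by rewrite divr_ge0 // ltW.
have LN0 : 0 <= L * (n + 1) by rewrite mulr_ge0 //; lra.
case: (eqVneq b l) => [->|bl].
  apply: le_trans (ler_wpM2l LN0 (samba_update_lead_ge a rw)).
  have -> : L * (n + 1) * ((1 - alpha) * p l) = K%:R * p l * (n + 1).
    by rewrite -LK; ring.
  by nra.
apply: le_trans (ler_wpM2l LN0 (samba_update_other_ge a rw bl)).
case/andP: (lead_ratio b); set x := p b / p l => x0 x1.
have pE : p b = x * p l by rewrite /x divfK // lt0r_neq0.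
have H1 : 1 - alpha * x <= L * n * p b * (1 - alpha * x).
  by rewrite ler_peMl //; nra.
have : alpha * x <= L * p b * (1 - alpha * x).
  have -> : L * p b * (1 - alpha * x) = L * (1 - alpha * x) * p l * x.
    by rewrite {1}pE; ring.
  rewrite ler_wpM2r ?(ltW x0) //.
  have : K%:R <= L * (1 - alpha * x) by rewrite -LK ler_wpM2l //; nra.
  move=> /(ler_wpM2r (ltW pl)); lra.
by lra.
Qed.

End SambaUpdate.

(** * Drift of the Lyapunov function *)

Definition potential {R : realType} (B M x : R) : R :=
  ln (1 - x) + M * (x^-1 - B * x).

(* [ln (1 + z) <= z] applied to the logarithmic part of the increment of the potential. *)
Definition potential_bound {R : realType} (B M x y : R) : R :=
  - (y - x) / (1 - x) + M * (y^-1 - x^-1 - B * (y - x)).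

Lemma potential_le {R : realType} (B M x y : R) : x < 1 -> y < 1 ->
  potential B M y - potential B M x <= potential_bound B M x y.
Proof.
move=> x1 y1; have q0 : 0 < 1 - x by lra.
have q0' : 0 < 1 - y by lra.
suff : ln (1 - y) - ln (1 - x) <= - (y - x) / (1 - x).
  by rewrite /potential /potential_bound; lra.
rewrite -ln_div ?posrE //.
have -> : (1 - y) / (1 - x) = 1 + - (y - x) / (1 - x) by field; lra.
apply: le_ln1Dx; rewrite -subr_gt0.
have -> : - (y - x) / (1 - x) - -1 = (1 - y) / (1 - x) by field; lra.
exact: divr_gt0.
Qed.

Section ScalarDrift.
Variables (R : realType) (alpha k Delta rs eta c B M : R).
Hypothesis alpha01 : 0 < alpha < 1.
Hypothesis k_ge1 : 1 <= k.
Hypothesis c_ge0 : 0 <= c.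
Hypothesis rs_le1 : rs <= 1.
Hypothesis Delta_gt0 : 0 < Delta.
Hypothesis etaE : eta = rs / (1 + alpha) - (rs - Delta).
Hypothesis eta_gt0 : 0 < eta.
Hypothesis B_ge0 : 0 <= B.
Hypothesis M_ge0 : 0 <= M.
Hypothesis B_quad : (alpha * k / (1 - alpha)) ^+ 2 <= 2 * eta * (B * Delta).
Hypothesis M_eta : 2 * (Delta / k) <= M * eta.

(** Here [x] and [P] are the masses of the optimal arm and of the leader, [s] and [u] their
    corrupted means, and [k] stands for [K]. The logarithm and the [B] term combine into
    [- alpha * w * (s - u)]; the [1 / x] term gives the difference of two quotients, bounded in
    [T2]. *)
Lemma drift_suboptimal_lead (x P s u : R) :
  0 < x -> x <= P -> x + P <= 1 -> 1 <= k * P ->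
  0 <= s <= 1 -> 0 <= u <= 1 -> rs - c <= s -> u <= rs - Delta + c ->
  x * s * potential_bound B M x ((1 + alpha) * x)
  + P * u * potential_bound B M x (x * (1 - alpha * (x / P)))
  <= - (alpha * Delta / k) * (1 - x)
     + (2 * alpha * (1 + M * B) + M * alpha * ((1 - alpha)^-1 + 1)) * c.
Proof.
case/andP: alpha01 => a0 a1 x0 xP xP1 kP /andP[s0 s1] /andP[u0 u1] sge ule.
have P0 : 0 < P by lra.
set y := x / P; have xE : x = y * P by rewrite /y divfK // lt0r_neq0.
have y0 : 0 < y by rewrite divr_gt0.
have y1 : y <= 1 by rewrite ler_pdivrMr // mul1r.
have ay : 0 < 1 - alpha * y by nra.
have q0 : 0 < 1 - x by lra.
clearbody y; set w := x ^+ 2 * ((1 - x)^-1 + M * B).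
have -> : x * s * potential_bound B M x ((1 + alpha) * x)
    + P * u * potential_bound B M x (x * (1 - alpha * y))
  = - alpha * w * (s - u) + M * alpha * (u / (1 - alpha * y) - s / (1 + alpha)).
  rewrite /w /potential_bound; move: q0; rewrite xE => q0; field.
  by rewrite !lt0r_neq0 //; lra.
have MB : 0 <= M * B by rewrite mulr_ge0.
have w1 : M * B * x ^+ 2 <= w.
  rewrite /w mulrC ler_wpM2l ?sqr_ge0 // lerDr invr_ge0; exact: ltW.
have w2 : w <= 1 + M * B.
  rewrite /w mulrDr lerD //; last by rewrite ler_piMl // expr_le1 //; lra.
  by rewrite ler_pdivrMr // mul1r; nra.
have w0 : 0 <= w by apply: le_trans w1; rewrite mulr_ge0 ?sqr_ge0.
clearbody w; have D0 := ltW Delta_gt0; have a0' := ltW a0.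
(* Since [s - u >= Delta - 2 * c], the gain in [Delta] uses the lower bound [w1], whose quadratic
   term will offset the linear term of [T2], and the loss in [c] uses the upper bound [w2]. *)
have T1 : - alpha * w * (s - u) <=
    - alpha * Delta * (M * B * x ^+ 2) + 2 * alpha * (1 + M * B) * c.
  have : alpha * w * (Delta - 2 * c) <= alpha * w * (s - u).
    by rewrite ler_wpM2l ?mulr_ge0 //; lra.
  have : alpha * Delta * (M * B * x ^+ 2) <= alpha * Delta * w.
    by rewrite ler_wpM2l ?mulr_ge0.
  have : 2 * alpha * c * w <= 2 * alpha * c * (1 + M * B).
    by rewrite ler_wpM2l ?mulr_ge0.
  by lra.
have T2 : u / (1 - alpha * y) - s / (1 + alpha) <=
    - eta + alpha * k / (1 - alpha) * x + ((1 - alpha)^-1 + 1) * c.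
  set i := (1 - alpha * y)^-1; set j := (1 - alpha)^-1.
  have ij : i <= j by rewrite /i /j lef_pV2 ?posrE //; nra.
  have j0 : 0 < j by rewrite invr_gt0; lra.
  (* splitting [1] off [i] keeps the limit [rs / (1 + alpha) - rho] sharp as [y] tends to [0] *)
  have iE : i = 1 + alpha * y * i by rewrite /i; field; lra.
  have yk : y <= k * x by rewrite xE; nra.
  have i0 : 0 < i by rewrite invr_gt0.
  have y0' := ltW y0; have i0' := ltW i0.
  have e1 : u * i <= (rs - Delta) * i + c * i by rewrite -mulrDl ler_wpM2r // ltW.
  have e2 : c * i <= c * j by rewrite ler_wpM2l.
  have e3 : alpha * y * i <= alpha * (k * x) * j.
    by apply: ler_pM; rewrite ?mulr_ge0 // ler_wpM2l.
  have e4 : (rs - Delta) * (alpha * y * i) <= alpha * y * i.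
    by apply: ler_piMl; [rewrite !mulr_ge0 | rewrite lerBlDr ler_wpDr].
  have e5 : (rs - c) / (1 + alpha) <= s / (1 + alpha).
    by rewrite ler_wpM2r // invr_ge0; lra.
  have a1p : 0 < 1 + alpha by lra.
  have e6 : c / (1 + alpha) <= c.
    by rewrite ler_pdivrMr // mulrDr mulr1 lerDl mulr_ge0.
  have e7 : (rs - Delta) * i = (rs - Delta) + (rs - Delta) * (alpha * y * i).
    by rewrite {1}iE; ring.
  rewrite etaE; lra.
have Ma : 0 <= M * alpha by rewrite mulr_ge0 // ltW.
have T3 : - eta + alpha * k / (1 - alpha) * x - Delta * B * x ^+ 2 <= - (eta / 2).
  have Bq := B_quad; set D := alpha * k / (1 - alpha) in Bq *.
  (* AM-GM: [2 eta D x <= eta^2 + D^2 x^2] *)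
  have : 0 <= (eta - D * x) ^+ 2 by exact: sqr_ge0.
  have : D ^+ 2 * x ^+ 2 <= 2 * eta * (B * Delta) * x ^+ 2.
    by rewrite ler_wpM2r ?sqr_ge0.
  rewrite -subr_ge0 => h1 h2; rewrite -subr_ge0 -(pmulr_rge0 _ eta_gt0).
  by lra.
(* By [M_eta], the leftover [- M * alpha * eta / 2] is at most [- alpha * Delta / k]. *)
have T4 : M * alpha * (- eta + alpha * k / (1 - alpha) * x - Delta * B * x ^+ 2)
    <= - (alpha * Delta / k) * (1 - x).
  apply: le_trans (ler_wpM2l Ma T3) _.
  have : alpha * (2 * (Delta / k)) <= alpha * (M * eta) by rewrite ler_wpM2l // ltW.
  have : 0 <= alpha * (Delta / k) * x.
    by rewrite !mulr_ge0 ?invr_ge0 ?(ltW x0) // (le_trans ler01 k_ge1).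
  by lra.
have := ler_wpM2l Ma T2.
by lra.
Qed.

(** The mass [x] increases, so the change of [1 / x] is negative and is dropped. The factor [s] is
    kept exact so that it cancels against the pulls of the other arms. *)
Lemma drift_optimal_lead_reward (x s S : R) : 0 < x < 1 -> 0 <= s -> 0 <= S ->
  x * s * potential_bound B M x (x + alpha * S / x)
  <= - (alpha * S * s * ((1 - x)^-1 + M * B)).
Proof.
case/andP: alpha01 => a0 a1 /andP[x0 x1] s0 S0.
have h : (x + alpha * S / x)^-1 - x^-1 <= 0.
  have z0 : 0 <= alpha * S / x by rewrite divr_ge0 ?mulr_ge0 // ltW.
  by rewrite subr_le0 lef_pV2 ?posrE //; lra.
have : x * s * M * ((x + alpha * S / x)^-1 - x^-1) <= 0.
  by rewrite mulr_ge0_le0 // !mulr_ge0 // ltW.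
have -> : x * s * potential_bound B M x (x + alpha * S / x) =
  x * s * M * ((x + alpha * S / x)^-1 - x^-1)
  - (alpha * S * s * ((1 - x)^-1 + M * B)).
  rewrite /potential_bound; set z := (x + _)^-1; field.
  by rewrite ?lt0r_neq0 //; lra.
by lra.
Qed.

(** A rewarded pull of a suboptimal arm of mass [y] has probability [y * t] and costs the leader
    [alpha * y], so every contribution is of order [y ^+ 2]. The change of [1 / x] is controlled by
    [x >= 1 / k] and [x - alpha * y >= (1 - alpha) * x]. *)
Lemma drift_optimal_lead_explore (x y s t : R) : 0 < y -> y <= x -> x < 1 ->
  1 <= k * x -> 0 <= t <= 1 -> t <= s - Delta + 2 * c ->
  y * t * potential_bound B M x (x - alpha * y)
  <= alpha * ((s - Delta + 2 * c) * ((1 - x)^-1 + M * B)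
       + M * (k ^+ 2 / (1 - alpha))) * y ^+ 2.
Proof.
case/andP: alpha01 => a0 a1 y0 yx x1 kx /andP[t0 t1] ts.
have x0 : 0 < x by lra.
have q0 : 0 < 1 - x by lra.
have xy : (1 - alpha) * x <= x - alpha * y by nra.
have ax : 0 < (1 - alpha) * x by rewrite mulr_gt0 //; lra.
have xy0 : 0 < x - alpha * y by lra.
have -> : y * t * potential_bound B M x (x - alpha * y) =
   alpha * y ^+ 2 * (t * ((1 - x)^-1 + M * B) + M * (t * (x^-1 / (x - alpha * y)))).
  by rewrite /potential_bound; field; rewrite ?lt0r_neq0.
have W0 : 0 <= (1 - x)^-1 + M * B.
  by rewrite addr_ge0 ?mulr_ge0 // invr_ge0 ltW.
have := ler_wpM2r W0 ts.
have xk : x^-1 <= k by rewrite -div1r ler_pdivrMr.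
have h : x^-1 / (x - alpha * y) <= k ^+ 2 / (1 - alpha).
  have : x^-1 / (x - alpha * y) <= x^-1 / ((1 - alpha) * x).
    by rewrite ler_wpM2l ?invr_ge0 ?(ltW x0) // lef_pV2 ?posrE.
  move/le_trans; apply.
  have -> : x^-1 / ((1 - alpha) * x) = x^-1 * x^-1 / (1 - alpha).
    by field; rewrite !lt0r_neq0 //; lra.
  rewrite ler_wpM2r ?invr_ge0; [|lra|].
    by [].
  by rewrite expr2 ler_pM // invr_ge0 ltW.
have h' : t * (x^-1 / (x - alpha * y)) <= k ^+ 2 / (1 - alpha).
  apply: le_trans h; rewrite ler_piMl // divr_ge0 ?(ltW xy0) // invr_ge0.
  exact: ltW.
have := ler_wpM2l M_ge0 h'.
move=> h1 h2.
have y2 : 0 <= alpha * y ^+ 2 by rewrite mulr_ge0 ?sqr_ge0 // ltW.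
have := ler_wpM2l y2 (lerD h2 h1).
by lra.
Qed.

End ScalarDrift.

Lemma exists_neq_ord (K : nat) (i : 'I_K) : (2 <= K)%N -> exists j : 'I_K, j != i.
Proof.
move=> K2; have [z|z] := eqVneq (val i) 0%N.
  by exists (Ordinal K2); rewrite -val_eqE /= z.
by exists (Ordinal (ltnW K2)); rewrite -val_eqE /= eq_sym.
Qed.

(** * Mass and squared mass of the suboptimal arms *)

Section SquareSums.
Variables (R : realType) (K : nat) (star : 'I_K) (p : 'I_K -> R).
Hypothesis p_gt0 : forall a, 0 < p a.
Hypothesis sum_p : \sum_a p a = 1.

Lemma sum_other : \sum_(a | a != star) p a = 1 - p star.
Proof. by have := sum_p; rewrite (bigD1 star) //= => <-; rewrite addrAC subrr add0r. Qed.

Lemma other_le a : a != star -> p a <= 1 - p star.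
Proof.
by move=> al; rewrite -sum_other (bigD1 a) //= lerDl sumr_ge0 // => c _; exact: ltW.
Qed.

Lemma sum_sqr_other_le : \sum_(a | a != star) p a ^+ 2 <= (1 - p star) ^+ 2.
Proof.
rewrite [leRHS]expr2 -{2}sum_other mulr_sumr; apply: ler_sum => a al.
by rewrite expr2 ler_wpM2r ?other_le // ltW.
Qed.

(** Cauchy-Schwarz, through the tangent of the square at [q / K]: sum
    [2 * m * p a - m ^+ 2 <= p a ^+ 2] with [m = q / K], and bound the number of suboptimal arms by
    [K]. *)
Lemma sum_sqr_other_ge :
  (1 - p star) ^+ 2 / K%:R <= \sum_(a | a != star) p a ^+ 2.
Proof.
have K0 : 0 < K%:R :> R by rewrite ltr0n (leq_ltn_trans _ (ltn_ord star)).
set q := 1 - p star.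
have : \sum_(a | a != star) (2 * (q / K%:R) * p a - (q / K%:R) ^+ 2)
    <= \sum_(a | a != star) p a ^+ 2.
  by apply: ler_sum => a _; have := sqr_ge0 (p a - q / K%:R); lra.
apply: le_trans; rewrite sumrB -mulr_sumr sum_other -/q.
have : \sum_(a : 'I_K | a != star) (q / K%:R) ^+ 2 <= K%:R * (q / K%:R) ^+ 2.
  have -> : K%:R * (q / K%:R) ^+ 2 = \sum_(a : 'I_K) (q / K%:R) ^+ 2.
    by rewrite sumr_const card_ord mulr_natl.
  by rewrite [leRHS](bigD1 star) //= lerDr sqr_ge0.
have -> : K%:R * (q / K%:R) ^+ 2 = q ^+ 2 / K%:R by field; rewrite lt0r_neq0.
have -> : 2 * (q / K%:R) * q = 2 * (q ^+ 2 / K%:R) by field; rewrite lt0r_neq0.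
by lra.
Qed.

End SquareSums.

(** * Expected drift of the potential in one round *)

Section SambaDrift.
Variables (R : realType) (K : nat) (alpha Delta eta B M c : R).
Variables (star l : 'I_K) (r s p : 'I_K -> R).
Hypothesis alpha01 : 0 < alpha < 1.
Hypothesis K_ge2 : (2 <= K)%N.
Hypothesis p_gt0 : forall a, 0 < p a.
Hypothesis sum_p : \sum_a p a = 1.
Hypothesis lead_p : forall a, p a <= p l.
Hypothesis r_gap : forall a, a != star -> Delta <= r star - r a.
Hypothesis s01 : forall a, 0 <= s a <= 1.
Hypothesis s_r : forall a, `|r a - s a| <= c.
Hypothesis c_ge0 : 0 <= c.
Hypothesis rs_le1 : r star <= 1.
Hypothesis Delta_gt0 : 0 < Delta.
Hypothesis etaE : eta = r star / (1 + alpha) - (r star - Delta).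
Hypothesis eta_gt0 : 0 < eta.
Hypothesis B_ge0 : 0 <= B.
Hypothesis M_ge0 : 0 <= M.
Hypothesis B_quad : (alpha * K%:R / (1 - alpha)) ^+ 2 <= 2 * eta * (B * Delta).
Hypothesis B_sqr : K%:R ^+ 2 / (1 - alpha) <= B * Delta.
Hypothesis M_eta : 2 * (Delta / K%:R) <= M * eta.

Let kappa := alpha * Delta / K%:R.
Let cost_coef := 2 * alpha * (1 + M * B) + M * alpha * ((1 - alpha)^-1 + 1).
Let K_ge1 : 1 <= K%:R :> R.
Proof. by rewrite ler1n ltnW. Qed.

Let potbound a := potential_bound B M (p star) (samba_update alpha l p a true star).

Lemma expected_drift_suboptimal_lead : l != star ->
  \sum_a p a * s a * potbound a <= - kappa * (1 - p star) + cost_coef * c.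
Proof.
move=> ls; have sl : star != l by rewrite eq_sym.
(* Rewarded pulls of arms other than [star] and [l] leave [p star] unchanged and contribute
   nothing. *)
rewrite (bigD1 star) //= (bigD1 l) //= addrA [X in _ + X]big1 ?addr0; last first.
  move=> a /andP[/negPf as_ /negPf al]; rewrite /potbound samba_update_other //.
  by rewrite as_ al /potential_bound; ring.
rewrite /potbound !samba_update_other //.
rewrite eqxx (negPf ls) eqxx.
have := s_r star; have := s_r l; rewrite !ler_norml => /andP[h1 h2] /andP[h3 h4].
have hl := r_gap ls.
apply: (drift_suboptimal_lead (rs := r star) (eta := eta)) => //; try lra.
  by have := other_le p_gt0 sum_p ls; lra.
exact: lead_ge_invK.
Qed.

Lemma expected_drift_optimal_lead : l = star ->
  \sum_a p a * s a * potbound a <= - kappa * (1 - p star) + cost_coef * c.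
Proof.
move=> ls; case/andP: alpha01 => a0 a1.
have [b bs] := exists_neq_ord star K_ge2.
have q0 : 0 < 1 - p star by apply: lt_le_trans (other_le p_gt0 sum_p bs).
have x0 := p_gt0 star; set x := p star in q0 x0 *.
set S := \sum_(a | a != star) p a ^+ 2.
set W := (1 - x)^-1 + M * B.
have S0 : 0 <= S by apply: sumr_ge0 => a _; exact: sqr_ge0.
have s0 a : 0 <= s a by case/andP: (s01 a).
have hstar : p star * s star * potbound star <= - (alpha * S * s star * W).
  rewrite /potbound -ls samba_update_lead // eqxx ls.
  by apply: drift_optimal_lead_reward => //; apply/andP; split => //; rewrite -subr_gt0.
have hother : \sum_(a | a != star) p a * s a * potbound a <=
    alpha * ((s star - Delta + 2 * c) * W + M * (K%:R ^+ 2 / (1 - alpha))) * S.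
  rewrite mulr_sumr; apply: ler_sum => a al.
  rewrite /potbound -[in samba_update _ _ _ _ _ _]ls samba_update_lead // ls (negPf al).
  apply: drift_optimal_lead_explore => //.
  - by rewrite -ls.
  - by rewrite -subr_gt0.
  - by rewrite -ls; exact: lead_ge_invK.
  have := s_r star; have := s_r a; rewrite !ler_norml => /andP[h1 h2] /andP[h3 h4].
  by have := r_gap al; lra.
rewrite (bigD1 star) //=; apply: le_trans (lerD hstar hother) _.
have S_le : S <= (1 - x) ^+ 2 by exact: sum_sqr_other_le.
have S_ge : (1 - x) ^+ 2 / K%:R <= S by exact: sum_sqr_other_ge.
clearbody x S; clear ls; have MB : 0 <= M * B by rewrite mulr_ge0.
have i0 : 0 < (1 - x)^-1 by rewrite invr_gt0.
have SW : S * W <= 1 + M * B.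
  rewrite /W mulrDr lerD //.
    by rewrite ler_pdivrMr // mul1r (le_trans S_le) // expr2 ler_piMr //; lra.
  by rewrite ler_piMl // (le_trans S_le) // expr_le1 //; lra.
have Sq : (1 - x) / K%:R <= S / (1 - x).
  by rewrite ler_pdivlMr // mulrAC -expr2.
have e1 : alpha * c * (S * W) <= alpha * c * (1 + M * B).
  by rewrite ler_wpM2l // mulr_ge0 // ltW.
have e2 : alpha * Delta * ((1 - x) / K%:R) <= alpha * Delta * (S / (1 - x)).
  by rewrite ler_wpM2l // mulr_ge0 // ltW.
have e3 : alpha * S * M * (K%:R ^+ 2 / (1 - alpha)) <= alpha * S * M * (B * Delta).
  by rewrite ler_wpM2l // !mulr_ge0 // ltW.
have e4 : 0 <= M * alpha * ((1 - alpha)^-1 + 1) * c.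
  by rewrite !mulr_ge0 ?addr_ge0 ?invr_ge0 ?(ltW a0) //; lra.
(* The terms in [s star] cancel. Of the remaining gain [alpha * Delta * S * W], the part with
   [M * B] beats the drift of [1 / x] by [B_sqr], and the part with [1 / (1 - x)] yields
   [kappa * (1 - x)]. *)
have -> : - (alpha * S * s star * W)
  + alpha * ((s star - Delta + 2 * c) * W + M * (K%:R ^+ 2 / (1 - alpha))) * S
  = 2 * (alpha * c * (S * W)) - alpha * Delta * (S / (1 - x))
    + alpha * S * M * (K%:R ^+ 2 / (1 - alpha)) - alpha * S * M * (B * Delta).
  by rewrite /W; ring.
rewrite /kappa /cost_coef; lra.
Qed.

(** An unrewarded round leaves [p] unchanged, so only rewarded pulls contribute to the drift. A
    second arm of positive mass keeps [p star] below 1 before and after the update, as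
    [potential_le] requires. *)
Lemma expected_potential_le :
  \sum_a p a * (s a * potential B M (samba_update alpha l p a true star)
              + (1 - s a) * potential B M (samba_update alpha l p a false star))
  <= potential B M (p star) - kappa * (1 - p star) + cost_coef * c.
Proof.
have [b bs] := exists_neq_ord star K_ge2.
have lt1 (q : 'I_K -> R) : (forall a, 0 < q a) -> \sum_a q a = 1 -> q star < 1.
  move=> q0 q1; rewrite -subr_gt0; exact: lt_le_trans (other_le q0 q1 bs).
apply: (@le_trans _ _ (potential B M (p star) + \sum_a p a * s a * potbound a)).
  rewrite -[X in X + _]mul1r -[X in X * _ + _]sum_p mulr_suml -big_split /=.
  apply: ler_sum => a _; rewrite samba_update_noreward //.
  have := @potential_le R B M (p star) (samba_update alpha l p a true star).
  rewrite -/(potbound a) => h.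
  have {h} : potential B M (samba_update alpha l p a true star) - potential B M (p star)
      <= potbound a.
    apply: h; apply: lt1 => // [b'|]; [exact: samba_update_gt0|exact: sum_samba_update].
  have ps : 0 <= p a * s a by case/andP: (s01 a) => ? _; rewrite mulr_ge0 // ltW.
  by move=> /(ler_wpM2l ps); lra.
have : \sum_a p a * s a * potbound a <= - kappa * (1 - p star) + cost_coef * c.
  case: (eqVneq l star) => ls; first exact: expected_drift_optimal_lead.
  exact: expected_drift_suboptimal_lead.
by lra.
Qed.

End SambaDrift.

(** * Expectations over histories *)

Lemma big_tuple_cons (R : nmodType) (A : finType) (T : nat) (f : seq A -> R) :
  \sum_(w : T.+1.-tuple A) f w = \sum_(w : T.-tuple A) \sum_(x : A) f (x :: w).
Proof.
rewrite pair_big /= (reindex (fun z : T.-tuple A * A => [tuple of z.2 :: z.1])) //=.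
exists (fun w : T.+1.-tuple A => ([tuple of behead w], thead w)) => [[w x] _|w _] /=.
  by congr (_, _); apply: val_inj.
by rewrite [RHS]tuple_eta.
Qed.

Section Expectation.
Variables (R : realType) (K : nat).
Variables (lead : hist K -> ('I_K -> R) -> 'I_K) (alpha : R) (adv : hist K -> 'I_K -> R).
Hypothesis lead_max : forall h p b, p b <= p (lead h p).
Hypothesis K_gt0 : (0 < K)%N.
Hypothesis alpha01 : 0 < alpha < 1.
Hypothesis adv01 : forall h a, 0 <= adv h a <= 1.

Local Notation P := (samba_p lead alpha).

Lemma samba_p_gt0_sum h : (forall a, 0 < P h a) /\ \sum_a P h a = 1.
Proof.
elim: h => [|x h [p0 p1]] /=; split.
- by move=> a; rewrite divr_gt0 ?ltr0n.
- by rewrite sumr_const card_ord -[LHS]mulr_natl mulrC divfK // pnatr_eq0 -lt0n.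
- by move=> a; apply: samba_update_gt0.
- exact: sum_samba_update.
Qed.

Lemma samba_p_lower h b : 1 <= K%:R / (1 - alpha) * ((size h)%:R + 1) * P h b.
Proof.
case/andP: alpha01 => a0 a1.
elim: h => [|x h IH] /=.
  rewrite add0r mulr1 mul1r mulrAC divff ?pnatr_eq0 -?lt0n // mul1r.
  by rewrite invf_ge1; lra.
have [p0 p1] := samba_p_gt0_sum h.
by rewrite -[(size h).+1]addn1 natrD samba_update_decay // lerDr.
Qed.

Definition expect (T : nat) (f : hist K -> R) : R :=
  \sum_(w : T.-tuple ('I_K * bool)) hist_prob lead alpha adv w * f w.

(** The conditional expectation of [f] after one more round, given the history [h]. *)
Definition next_mean (f : hist K -> R) (h : hist K) : R :=
  \sum_a P h a * (adv h a * f ((a, true) :: h) + (1 - adv h a) * f ((a, false) :: h)).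

Lemma expect0 f : expect 0 f = f [::].
Proof.
rewrite /expect (big_pred1 [tuple]) ?mul1r // => w.
by apply/esym/eqP; exact: tuple0.
Qed.

Lemma expectS T f : expect T.+1 f = expect T (next_mean f).
Proof.
rewrite /expect (big_tuple_cons T (fun h => hist_prob lead alpha adv h * f h)).
apply: eq_bigr => w _; rewrite mulr_sumr.
transitivity (\sum_a \sum_b hist_prob lead alpha adv ((a, b) :: w) * f ((a, b) :: w)).
  by rewrite pair_big /=; apply: eq_bigr => -[a b].
by apply: eq_bigr => a _; rewrite big_bool /=; ring.
Qed.

Lemma hist_prob_ge0 h : 0 <= hist_prob lead alpha adv h.
Proof.
elim: h => //= x h IH; have [p0 _] := samba_p_gt0_sum h.
rewrite !mulr_ge0 //; first exact: ltW.
by case/andP: (adv01 h x.1); case: ifP => _; rewrite ?subr_ge0.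
Qed.

Lemma expect_le T f g : (forall h, size h = T -> f h <= g h) -> expect T f <= expect T g.
Proof.
move=> fg; apply: ler_sum => w _; rewrite ler_wpM2l ?hist_prob_ge0 //.
by apply: fg; rewrite size_tuple.
Qed.

(** A supermartingale has expectation at most its initial value. *)
Lemma expect_le_start f T : (forall h, next_mean f h <= f h) -> expect T f <= f [::].
Proof.
move=> super; elim: T => [|T IH]; first by rewrite expect0.
by rewrite expectS; apply: le_trans IH; apply: expect_le.
Qed.

Lemma expectZ T z f : expect T (fun h => z * f h) = z * expect T f.
Proof. by rewrite /expect mulr_sumr; apply: eq_bigr => w _; rewrite mulrCA. Qed.

Lemma next_mean_shift f g h (z : R) : (forall x, f (x :: h) = g (x :: h) + z) ->
  next_mean f h = next_mean g h + z.
Proof.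
move=> fg; have [_ p1] := samba_p_gt0_sum h.
rewrite -[X in _ = _ + X]mul1r -[X in _ = _ + X * _]p1 mulr_suml /next_mean -big_split.
by apply: eq_bigr => a _; rewrite !fg /=; ring.
Qed.

Variables (r : 'I_K -> R) (star : 'I_K).

(** Histories start with the latest round, so [drop (size h - t) h] is the history before round [t].
    The sum is predictable: its last term does not involve the last observation. *)
Definition missed (h : hist K) : R :=
  \sum_(t < size h) (1 - P (drop (size h - t) h) star).

Lemma missed_cons x h : missed (x :: h) = missed h + (1 - P h star).
Proof.
rewrite /missed /= big_ord_recr /= subSn // subnn /= drop0; congr (_ + _).
by apply: eq_bigr => t _; rewrite subSn // ltnW.
Qed.

Lemma total_cost_cons x h :
  total_cost adv r (x :: h) = total_cost adv r h + corr_cost adv r h.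
Proof.
rewrite /total_cost /= big_ord_recr /= subSn // subnn /= drop0; congr (_ + _).
by apply: eq_bigr => t _; rewrite subSn // ltnW.
Qed.

(** Each gap is bounded by 1, after which the masses of the suboptimal arms add up to [1 - p star]
    in each round. *)
Lemma regret_le_missed T : (forall a, r star - r a <= 1) ->
  regret lead alpha adv r star T <= expect T missed.
Proof.
move=> gap1; rewrite /regret.
apply: (@le_trans _ _ (\sum_(a | a != star)
    \sum_(w : T.-tuple ('I_K * bool))
       hist_prob lead alpha adv w * \sum_(t < T) P (drop (T - t) w) a)).
  apply: ler_sum => a _; rewrite ler_piMl //; apply: sumr_ge0 => w _.
  rewrite mulr_ge0 ?hist_prob_ge0 // sumr_ge0 // => t _.
  by apply: ltW; case: (samba_p_gt0_sum (drop (T - t) w)).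
rewrite exchange_big /=; apply: ler_sum => w _; rewrite -mulr_sumr.
rewrite ler_wpM2l ?hist_prob_ge0 // exchange_big /= /missed size_tuple.
apply: ler_sum => t _; have [p0 p1] := samba_p_gt0_sum (drop (T - t) w).
by rewrite (sum_other _ p1).
Qed.

(** * Supermartingale argument bounding the expected missed mass *)

Variables (Delta eta B M C : R).
Hypothesis K_ge2 : (2 <= K)%N.
Hypothesis r_gap : forall a, a != star -> Delta <= r star - r a.
Hypothesis rs_le1 : r star <= 1.
Hypothesis Delta_gt0 : 0 < Delta.
Hypothesis etaE : eta = r star / (1 + alpha) - (r star - Delta).
Hypothesis eta_gt0 : 0 < eta.
Hypothesis B_ge0 : 0 <= B.
Hypothesis M_ge0 : 0 <= M.
Hypothesis B_quad : (alpha * K%:R / (1 - alpha)) ^+ 2 <= 2 * eta * (B * Delta).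
Hypothesis B_sqr : K%:R ^+ 2 / (1 - alpha) <= B * Delta.
Hypothesis M_eta : 2 * (Delta / K%:R) <= M * eta.
Hypothesis cost_le : forall h, total_cost adv r h <= C.

Let kappa := alpha * Delta / K%:R.
Let cost_coef := 2 * alpha * (1 + M * B) + M * alpha * ((1 - alpha)^-1 + 1).
Let L := K%:R / (1 - alpha).

Lemma corr_cost_ge0 h : 0 <= corr_cost adv r h.
Proof. exact: bigmax_ge_id. Qed.

Lemma next_potential_le h :
  next_mean (fun h => potential B M (P h star)) h <=
  potential B M (P h star) - kappa * (1 - P h star) + cost_coef * corr_cost adv r h.
Proof.
have [p0 p1] := samba_p_gt0_sum h.
apply: (expected_potential_le (r := r) (eta := eta)) => //; last exact: corr_cost_ge0.
by move=> a; apply: le_bigmax.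
Qed.

(** The mass [1 - p star] is at least that of any one suboptimal arm, which [samba_p_lower] bounds
    below; the [1 / x] term is nonnegative and is dropped. *)
Lemma potential_lower h :
  - (ln (L * ((size h)%:R + 1)) + M * B) <= potential B M (P h star).
Proof.
have [p0 p1] := samba_p_gt0_sum h; have [b bs] := exists_neq_ord star K_ge2.
have a1 : 0 < 1 - alpha by rewrite subr_gt0; case/andP: alpha01.
have L0 : 0 < L * ((size h)%:R + 1).
  by rewrite mulr_gt0 ?divr_gt0 ?ltr0n // ltr_wpDl.
have q0 := other_le p0 p1 bs.
have : 0 <= ln (L * ((size h)%:R + 1)) + ln (1 - P h star).
  have q0' := lt_le_trans (p0 b) q0.
  rewrite -lnM ?posrE // ln_ge0 // (le_trans (samba_p_lower h b)) //.
  by rewrite ler_wpM2l // ltW.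
have : 0 <= M * (P h star)^-1 by rewrite mulr_ge0 // invr_ge0 ltW.
have : M * B * P h star <= M * B.
  rewrite ler_piMr ?mulr_ge0 // -subr_ge0; apply: ltW; exact: lt_le_trans q0.
by rewrite /potential; lra.
Qed.

Lemma expect_missed_le T :
  kappa * expect T missed <=
  M * K%:R + ln (L * (T%:R + 1)) + M * B + cost_coef * C.
Proof.
(* This is the compensated supermartingale. The constant is chosen so that [f] dominates
   [kappa * missed] at time [T], by [potential_lower] and the budget [C]. *)
pose f h := potential B M (P h star) + (kappa * missed h - cost_coef * total_cost adv r h
  + (ln (L * (T%:R + 1)) + M * B + cost_coef * C)).
have cc0 : 0 <= cost_coef.
  case/andP: alpha01 => a0 a1.
  by rewrite addr_ge0 // mulr_ge0 ?addr_ge0 ?mulr_ge0 ?invr_ge0 //; lra.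
have f0 : f [::] <= M * K%:R + ln (L * (T%:R + 1)) + M * B + cost_coef * C.
  rewrite /f /missed /total_cost !big_ord0 /= /potential div1r invrK.
  have k1 : K%:R^-1 < 1 :> R by rewrite invf_lt1 ?ltr0n // ltr1n.
  have k0 : 0 < K%:R^-1 :> R by rewrite invr_gt0 ltr0n.
  have : ln (1 - K%:R^-1) <= 0 :> R by apply: ln_le0; lra.
  have : 0 <= M * (B * K%:R^-1) by rewrite !mulr_ge0 // ltW.
  by lra.
apply: le_trans f0; apply: le_trans (expect_le_start _ _); last first.
  (* The observation [(star, true)] is a placeholder: [missed] and [total_cost] of [x :: h] do not
     depend on [x]. *)
  move=> h; rewrite (@next_mean_shift _ (fun h => potential B M (P h star)) h
    (kappa * missed ((star, true) :: h) - cost_coef * total_cost adv r ((star, true) :: h)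
     + (ln (L * (T%:R + 1)) + M * B + cost_coef * C))); last first.
    by move=> x; rewrite /f !missed_cons !total_cost_cons.
  have := next_potential_le h.
  by rewrite /f missed_cons total_cost_cons; lra.
rewrite -expectZ; apply: expect_le => h hT; rewrite /f.
have := potential_lower h; rewrite hT.
have := ler_wpM2l cc0 (cost_le h).
by lra.
Qed.

End Expectation.

(** * Choice of the constants and conclusion *)

Unset Implicit Arguments.

Theorem theorem1 (R : realType) (K : nat) (r : 'I_K -> R) (astar : 'I_K)
    (Delta alpha : R) :
  (2 <= K)%N ->
  (forall a, 0 <= r a <= 1) ->
  (forall a, a != astar -> r a < r astar) ->
  (forall a, a != astar -> Delta <= r astar - r a) ->
  (exists2 a, a != astar & Delta = r astar - r a) ->
  0 < alpha < 1 ->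
  alpha * (r astar - Delta) < Delta ->
  exists c1 c2 : R, 0 < c1 /\ 0 < c2 /\
    forall (lead : hist K -> ('I_K -> R) -> 'I_K),
    (forall h p b, p b <= p (lead h p)) ->
    forall (C : R), 0 <= C ->
    forall (adv : hist K -> 'I_K -> R),
    (forall h a, 0 <= adv h a <= 1) ->
    (forall h : hist K, total_cost adv r h <= C) ->
    forall T : nat, (2 <= T)%N ->
      regret lead alpha adv r astar T <=
        c1 * (K%:R / Delta) * ln (T%:R : R) + c2 * (C / Delta).
Proof.
move=> K2 r01 r_lt gap [a0 a0s a0E] alpha01 alpha_small.
case/andP: (alpha01) => al0 al1.
have Delta_gt0 : 0 < Delta by rewrite a0E subr_gt0; exact: r_lt.
have rs1 : r astar <= 1 by case/andP: (r01 astar).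
pose eta := r astar / (1 + alpha) - (r astar - Delta).
(* Positivity of [eta] is exactly the step size condition. *)
have eta0 : 0 < eta by rewrite subr_gt0 ltr_pdivlMr; lra.
have k0 : 0 < K%:R :> R by rewrite ltr0n ltnW.
have al1' : 0 < 1 - alpha by lra.
pose D2 := (alpha * K%:R / (1 - alpha)) ^+ 2.
pose K2a : R := K%:R ^+ 2 / (1 - alpha).
have D20 : 0 <= D2 by exact: sqr_ge0.
have K2a0 : 0 <= K2a by rewrite divr_ge0 ?sqr_ge0 // ltW.
(* The two summands serve the two lower bounds required of [B * Delta]: one for a suboptimal leader,
   one for an optimal leader. *)
pose B := (D2 / (2 * eta) + K2a) / Delta.
have De0 : 0 <= D2 / (2 * eta) by rewrite divr_ge0 // mulr_ge0 // ltW.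
have B0 : 0 <= B by rewrite divr_ge0 ?addr_ge0 // ltW.
have BD : B * Delta = D2 / (2 * eta) + K2a by rewrite /B divfK // lt0r_neq0.
pose M := 2 * (Delta / K%:R) / eta.
have M0 : 0 <= M by rewrite divr_ge0 ?mulr_ge0 ?invr_ge0 // ltW.
have Meta : 2 * (Delta / K%:R) <= M * eta by rewrite /M divfK // lt0r_neq0.
have Bq : D2 <= 2 * eta * (B * Delta).
  have -> : 2 * eta * (B * Delta) = D2 + 2 * eta * K2a.
    by rewrite BD; field; rewrite lt0r_neq0.
  by rewrite lerDl mulr_ge0 // mulr_ge0 // ltW.
have Bs : K2a <= B * Delta by rewrite BD lerDr.
pose kappa := alpha * Delta / K%:R.
have kappa0 : 0 < kappa by rewrite divr_gt0 // mulr_gt0.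
pose b := 2 * alpha * (1 + M * B) + M * alpha * ((1 - alpha)^-1 + 1).
have b0 : 0 < b.
  have MB0 : 0 <= M * B by exact: mulr_ge0.
  have Ma0 : 0 <= M * alpha by apply: mulr_ge0 => //; exact: ltW.
  have i0 : 0 < (1 - alpha)^-1 by rewrite invr_gt0.
  apply: ltr_wpDr; first by apply: mulr_ge0 => //; lra.
  by apply: mulr_gt0; lra.
pose L : R := K%:R / (1 - alpha).
have L1 : 1 <= L.
  have : 1 <= K%:R :> R by rewrite ler1n ltnW.
  by rewrite /L ler_pdivlMr //; lra.
have ln2 : 0 < ln 2 :> R by rewrite ln_gt0 // ltr1n.
pose A := M * K%:R + M * B + ln L.
have A0 : 0 <= A.
  by apply: addr_ge0; [apply: addr_ge0; apply: mulr_ge0|exact: ln_ge0].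
(* [A] collects the terms free of [T] and [C]; it is at most [A / ln 2 * ln T] because [T >= 2]. The
   extra 2 comes from [T + 1 <= T ^+ 2], and the factors [Delta / K] and [Delta] cancel the
   normalisation in the statement. *)
exists ((A / ln 2 + 2) / kappa * (Delta / K%:R)), (b * Delta / kappa).
split.
  apply: mulr_gt0; last exact: divr_gt0.
  by apply: divr_gt0 => //; apply: ltr_wpDl => //; apply: divr_ge0 => //; exact: ltW.
split; first by apply: divr_gt0 => //; exact: mulr_gt0.
move=> lead lead_max C C0 adv adv01 cost_le T T2.
have gap1 a : r astar - r a <= 1 by have /andP[] := r01 a; lra.
apply: le_trans (regret_le_missed lead_max (ltnW K2) alpha01 adv01 T gap1) _.
have H := expect_missed_le lead_max (ltnW K2) alpha01 adv01 K2 gap rs1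
  Delta_gt0 (erefl eta) eta0 B0 M0 Bq Bs Meta cost_le T.
rewrite -(ler_pM2l kappa0); apply: le_trans H _.
have T2' : 2 <= T%:R :> R by rewrite ler_nat.
have lnT : ln (L * (T%:R + 1)) <= ln L + 2 * ln T%:R.
  rewrite lnM ?posrE; [|lra..]; rewrite lerD2l mulr_natl -lnXn; last by lra.
  by rewrite ler_ln ?posrE; nra.
have lnT2 : A <= A / ln 2 * ln T%:R.
  rewrite mulrAC ler_pdivlMr // ler_wpM2l // ler_ln ?posrE //; lra.
have -> : kappa * ((A / ln 2 + 2) / kappa * (Delta / K%:R) * (K%:R / Delta) * ln T%:R
    + b * Delta / kappa * (C / Delta)) = (A / ln 2 + 2) * ln T%:R + b * C.
  by field; rewrite !lt0r_neq0.
rewrite -/L -/b; move: lnT lnT2; rewrite /A; lra.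
Qed.
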